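(* The exponential generating function of the type $B$ Cauchy numbers of the second kind $c_n^B$ is $$\sum_{n \geq 0} c_n^B\,\frac{x^n}{n!} = \frac{1-\sqrt{1-2x}}{(2x-1)\,\ln\sqrt{1-2x}} .$$
   Context: The type $B$ rising factorial is $[x]_n^B = (x+1)(x+3)(x+5)\cdots(x+2n-1)$ for $n\ge 1$, with $[x]_0^B = 1$. The type $B$ Cauchy numbers of the second kind are $c_n^B = \int_0^1 [x]_n^B\,dx$ for $n\ge 0$. The identity is one of formal power series in $x$ with rational coefficients: $\sqrt{1-2x}$ and $\ln\sqrt{1-2x}=\tfrac12\ln(1-2x)$ denote the usual power series expansions at $x=0$; numerator and denominator both vanish to order exactly $1$ at $x=0$, and the quotient is understood as the resulting power series. *)

(* Defs.v *)
From HB Require Import structures.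
From mathcomp Require Import all_boot all_order all_algebra.
From mathcomp Require Import all_classical all_reals all_analysis.

Set Implicit Arguments.
Unset Strict Implicit.
Unset Printing Implicit Defensive.

Import Order.TTheory GRing.Theory Num.Theory.

Local Open Scope ring_scope.

(* The formal power series \sum_n f n 'X^n is encoded as f.  The alias [fps]
   carries the Cauchy product, not the pointwise one of [nat -> K]. *)
Definition fps (K : Type) := nat -> K.

HB.instance Definition _ (K : comNzRingType) :=
  GRing.Lmodule.copy (fps K) (nat -> K^o).

Section FpsRing.
Variable K : comNzRingType.
Implicit Types f g h : fps K.

Definition fps_mul f g : fps K := fun n => \sum_(i < n.+1) f i * g (n - i)%N.

Definition fps_C (c : K) : fps K := fun n => c *+ (n == 0)%N.

Definition fps_X : fps K := fun n => (n == 1)%N%:R.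

Fact fps_mul_polyE f g n m : (n < m)%N ->
  fps_mul f g n = (\poly_(i < m) f i * \poly_(i < m) g i)`_n.
Proof.
move=> nm; rewrite coefM; apply: eq_bigr => i _; rewrite !coef_poly.
by rewrite (leq_ltn_trans (leq_ord i) nm) (leq_ltn_trans (leq_subr _ _) nm).
Qed.

Fact fps_mulC : commutative fps_mul.
Proof.
by move=> f g; apply/funext => n; rewrite !(@fps_mul_polyE _ _ n n.+1)// mulrC.
Qed.

Fact fps_mulA : associative fps_mul.
Proof.
move=> f g h; apply/funext => n.
pose T k := \poly_(i < n.+1) (k i : K).
transitivity (T f * (T g * T h))`_n.
  rewrite coefM; apply: eq_bigr => i _.
  rewrite coef_poly ltn_ord (@fps_mul_polyE _ _ _ n.+1)//.
  by rewrite ltnS leq_subr.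
rewrite mulrA coefM; apply: eq_bigr => i _.
rewrite (@fps_mul_polyE _ _ _ n.+1) ?ltn_ord//.
by rewrite [(T h)`__]coef_poly ltnS leq_subr.
Qed.

Fact fps_mul1f : left_id (fps_C 1) fps_mul.
Proof.
move=> f; apply/funext => n; rewrite /fps_mul big_ord_recl/= subn0 mul1r.
by rewrite big1 ?addr0// => i _; rewrite mul0r.
Qed.

Fact fps_mulDl : left_distributive fps_mul +%R.
Proof.
move=> f g h; apply/funext => n.
rewrite {1}/fps_mul; under eq_bigr do rewrite mulrDl.
by rewrite big_split.
Qed.

Fact fps_1_neq0 : fps_C 1 != 0.
Proof.
by apply/eqP => /(congr1 (fun f : fps K => f 0)) /eqP; rewrite oner_eq0.
Qed.

HB.instance Definition _ := GRing.Zmodule_isComNzRing.Build (fps K)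
  fps_mulA fps_mulC fps_mul1f fps_mulDl fps_1_neq0.

Lemma fps_mulE f g n : (f * g) n = \sum_(i < n.+1) f i * g (n - i)%N.
Proof. by []. Qed.

Lemma fps_addE f g n : (f + g) n = f n + g n.
Proof. by []. Qed.

Lemma fps_oppE f n : (- f) n = - f n.
Proof. by []. Qed.

Lemma fps_scaleE c f n : (c *: f) n = c * f n.
Proof. by []. Qed.

Lemma fps_1E n : (1 : fps K) n = (n == 0)%N%:R.
Proof. by []. Qed.

Lemma fps_XnE k n : (fps_X ^+ k) n = (n == k)%:R.
Proof.
elim: k n => [|k IHk] n; first by rewrite expr0.
rewrite exprS fps_mulE.
case: n => [|n]; first by rewrite big_ord1 mul0r.
rewrite !big_ord_recl/= mul0r add0r mul1r big1 ?addr0; last first.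
  by move=> i _; rewrite mul0r.
by rewrite IHk /bump/= subSS subn0 eqSS.
Qed.

(* f(c X) *)
Definition fps_dilate (c : K) f : fps K := fun n => c ^+ n * f n.

End FpsRing.

Arguments fps_X {K}.

Definition fps_map (K L : Type) (phi : K -> L) (f : fps K) : fps L :=
  fun n => phi (f n).

Section FpsField.
Variable K : fieldType.
Implicit Types f g : fps K.

(* fps_order 0 = 0 by convention. *)
Definition fps_order f : nat :=
  if pselect (exists n, f n != 0) is left e then ex_minn e else 0.

(* f / X^m, meaningful when m <= fps_order f *)
Definition fps_shift (m : nat) f : fps K := fun n => f (n + m)%N.

Fixpoint fps_inv_seq f (n : nat) : seq K :=
  if n is m.+1 then
    let s := fps_inv_seq f m in
    rcons s (((m == 0)%N%:R - \sum_(i < m) f (m - i)%N * s`_i) / f 0%N)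
  else [::].

(* The inverse when f 0 != 0: its coefficients are obtained successively from
   the equations (fps_inv f * f) n = (n == 0)%:R. *)
Definition fps_inv f : fps K := fun n => (fps_inv_seq f n.+1)`_n.

(* The quotient f / g in K[[X]], meaningful when g != 0 divides f, that is
   when fps_order g <= fps_order f (or f = 0); see [fps_divK]. *)
Definition fps_div f g : fps K :=
  let m := fps_order g in fps_shift m f * fps_inv (fps_shift m g).

Lemma size_fps_inv_seq f n : size (fps_inv_seq f n) = n.
Proof. by elim: n => //= n IHn; rewrite size_rcons IHn. Qed.

Lemma nth_fps_inv_seq f n i : (i < n)%N -> (fps_inv_seq f n)`_i = fps_inv f i.
Proof.
elim: n => // n IHn; rewrite ltnS leq_eqVlt => /predU1P[->//|lt_in].
by rewrite /= nth_rcons size_fps_inv_seq lt_in IHn.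
Qed.

Lemma fps_mulVf f : f 0%N != 0 -> fps_inv f * f = 1.
Proof.
move=> f0; apply/funext => n.
rewrite [LHS]big_ord_recr/= subnn {2}/fps_inv/= nth_rcons size_fps_inv_seq.
rewrite ltnn eqxx mulfVK// addrC.
under [X in _ - X]eq_bigr => i _ do
  rewrite nth_fps_inv_seq ?ltn_ord// mulrC.
by rewrite subrK.
Qed.

Lemma fps_orderP f : f != 0 ->
  f (fps_order f) != 0 /\ forall n, (n < fps_order f)%N -> f n = 0.
Proof.
move=> f_neq0; rewrite /fps_order; case: pselect => [e|ne].
  case: ex_minnP => m fm min_m; split=> // n; rewrite ltnNge.
  by apply: contraNeq => /min_m.
case/eqP: f_neq0; apply/funext => n; apply/eqP.
by apply: contra_notT ne => fn; exists n.
Qed.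

Lemma fps_shiftK m f : (forall n, (n < m)%N -> f n = 0) ->
  fps_shift m f * fps_X ^+ m = f.
Proof.
move=> f0; apply/funext => n; rewrite fps_mulE.
have [lt_nm|le_mn] := ltnP n m.
  rewrite f0// big1// => i _; rewrite fps_XnE ltn_eqF ?mulr0//.
  exact: leq_ltn_trans (leq_subr _ _) lt_nm.
have lt_n : (n - m < n.+1)%N by rewrite ltnS leq_subr.
rewrite (bigD1 (Ordinal lt_n))//= big1 => [|i ne_i].
  by rewrite fps_XnE subKn// eqxx mulr1 addr0 /fps_shift subnK.
rewrite fps_XnE; case: eqP => [e|_]; last by rewrite mulr0.
case/eqP: ne_i; apply/val_inj => /=; rewrite -e subKn//.
by rewrite -ltnS.
Qed.

Lemma fps_divK f g : g != 0 -> (forall n, (n < fps_order g)%N -> f n = 0) ->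
  fps_div f g * g = f.
Proof.
move=> /fps_orderP[gm g_lt] f_lt; rewrite /fps_div.
rewrite -[X in _ * X](fps_shiftK g_lt) mulrA -(mulrA _ (fps_inv _)).
by rewrite fps_mulVf ?mulr1 ?fps_shiftK.
Qed.

(* (1 + X)^a = \sum_n binom(a, n) X^n *)
Definition fps_binomial (a : K) : fps K :=
  fun n => (\prod_(i < n) (a - i%:R)) / n`!%:R.

(* ln (1 + X) = \sum_(n >= 1) (-1)^(n-1) X^n / n *)
Definition fps_ln1D : fps K :=
  fun n => if n is m.+1 then (-1) ^+ m / m.+1%:R else 0.

Definition egf (a : nat -> K) : fps K := fun n => a n / n`!%:R.

End FpsField.

Definition sqrt1m2X : fps rat := fps_dilate (- 2) (fps_binomial 2^-1).

Definition ln1m2X : fps rat := fps_dilate (- 2) (fps_ln1D rat).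

Definition ln_sqrt1m2X : fps rat := 2^-1 *: ln1m2X.

Section Cauchy.
Variable R : realType.

Definition rising_factorialB (x : R) (n : nat) : R :=
  \prod_(1 <= i < n.+1) (x + (2 * i - 1)%N%:R).

Definition cauchyB (n : nat) : R :=
  (\int[lebesgue_measure]_(x in `[0%R, 1%R]%classic) rising_factorialB x n)%R.

End Cauchy.

Lemma fps_order_eq1 (K : fieldType) (f : fps K) :
  f 0%N = 0 -> f 1%N != 0 -> fps_order f = 1%N.
Proof.
move=> f0 f1; have /fps_orderP[] : f != 0 by apply: contraNneq f1 => ->.
case: fps_order => [|[|k]]; [by rewrite f0 eqxx | by [] |].
by move=> _ /(_ 1%N isT) f1_eq0; rewrite f1_eq0 eqxx in f1.
Qed.

Lemma fps_order_numerator : fps_order (1 - sqrt1m2X) = 1%N.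
Proof.
apply: fps_order_eq1; rewrite fps_addE fps_oppE fps_1E.
  by rewrite /sqrt1m2X /fps_dilate /fps_binomial big_ord0 expr0 mul1r divr1 subrr.
rewrite /sqrt1m2X /fps_dilate /fps_binomial big_ord1 expr1 subr0 divr1.
by rewrite mulNr mulfV ?pnatr_eq0// opprK add0r oner_eq0.
Qed.

Lemma fps_order_denominator :
  fps_order ((2 * fps_X - 1) * ln_sqrt1m2X) = 1%N.
Proof.
have l0 : ln_sqrt1m2X 0%N = 0 by [].
have l1 : ln_sqrt1m2X 1%N != 0.
  rewrite /ln_sqrt1m2X fps_scaleE /ln1m2X /fps_dilate /fps_ln1D.
  rewrite expr0 expr1 divr1.
  by rewrite mulrN mulVf ?pnatr_eq0// oppr_eq0 oner_eq0.
apply: fps_order_eq1; first by rewrite fps_mulE big_ord1 l0 mulr0.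
rewrite fps_mulE big_ord_recl big_ord1 [X in _ + X]mulr0 addr0.
by rewrite fps_addE fps_oppE fps_1E fps_mulE big_ord1 mulr0 add0r mulN1r oppr_eq0.
Qed.

(* Main.v *)
Require Import Defs.
From mathcomp Require Import all_boot all_order all_algebra.
From mathcomp Require Import all_classical all_reals all_analysis.
From mathcomp Require Import ring.
Import Order.TTheory GRing.Theory Num.Theory.
Local Open Scope ring_scope.

(** Write t for the formal variable, x for the integration variable, and
    L = ln (sqrt (1 - 2 t)).  The binomial series gives
      \sum_n [x]_n^B t^n / n! = (1 - 2 t)^(- (x + 1) / 2),
    whose derivative with respect to x is - L times itself.  Integrating over
    x in [0, 1], coefficient by coefficient, the series G of the numbers c_n^B
    satisfies
      L * G = (1 - 2 t)^(-1/2) - (1 - 2 t)^(-1),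
    and multiplying by 2 t - 1 gives (2 t - 1) * L * G = 1 - sqrt (1 - 2 t).
    Power series over a field form an integral domain, so this determines G.

    All analysis is confined to polynomials: the coefficient of t^n is a
    polynomial in x, so the left-hand side above is handled as a power series
    over {poly K}.  The derivative in x ([deriv_x_rising_gf]) is obtained
    formally: as series in t, d/dx of the series and - L times the series
    solve the same first-order linear differential equation with the same
    constant term.  The fundamental theorem of calculus is then applied to each
    coefficient ([ln_sqrt1m2_mul_egf]).  The boundary values x = 0 and x = 1 are
    linked to sqrt (1 - 2 t) and to 1 by
      (1 - 2 t) * (1 - 2 t)^(- (x + 1) / 2) = (1 - 2 t)^(- (x - 2 + 1) / 2)
    ([mul_pow1m2]), at exponents 1/2 and 0. *)

Set Implicit Arguments.
Unset Strict Implicit.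

(** * Formal power series *)

Section FpsCalculus.
Variable K : comNzRingType.
Implicit Types f g : fps K.

Definition fps_deriv f : fps K := fun n => f n.+1 *+ n.+1.

Lemma fps_mulX0 f : (fps_X * f) 0%N = 0.
Proof. by rewrite fps_mulE big_ord1 mul0r. Qed.

Lemma fps_mulXS f n : (fps_X * f) n.+1 = f n.
Proof.
rewrite fps_mulE !big_ord_recl/= mul0r add0r mul1r big1 ?addr0; last first.
  by move=> i _; rewrite mul0r.
by rewrite /bump/= subSS subn0.
Qed.

Lemma mul_1m2XE f : (1 - 2 * fps_X) * f = f - (fps_X * f + fps_X * f).
Proof. ring. Qed.

Lemma fps_mul_1m2X0 f : ((1 - 2 * fps_X) * f) 0%N = f 0%N.
Proof.
by rewrite mul_1m2XE fps_addE fps_oppE fps_addE fps_mulX0 addr0 subr0.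
Qed.

Lemma fps_mul_1m2XS f n : ((1 - 2 * fps_X) * f) n.+1 = f n.+1 - 2 * f n.
Proof. rewrite mul_1m2XE fps_addE fps_oppE fps_addE fps_mulXS; ring. Qed.

Lemma fps_mulCE c f n : (fps_C c * f) n = c * f n.
Proof.
rewrite fps_mulE big_ord_recl/= subn0 big1 ?addr0// => i _.
by rewrite mul0r.
Qed.

Lemma fps_derivM f g :
  fps_deriv (f * g) = fps_deriv f * g + f * fps_deriv g.
Proof.
apply/funext => n; rewrite fps_addE [LHS]/fps_deriv !fps_mulE -sumrMnl.
transitivity (\sum_(i < n.+2) (f i *+ i * g (n.+1 - i)%N
              + f i * (g (n.+1 - i)%N *+ (n.+1 - i)%N))).
  apply: eq_bigr => i _; rewrite mulrnAl mulrnAr -mulrnDr subnKC//.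
  by rewrite -ltnS.
rewrite big_split/=; congr (_ + _).
  by rewrite big_ord_recl/= mulr0n mul0r add0r.
rewrite big_ord_recr/= subnn mulr0n mulr0 addr0; apply: eq_bigr => i _.
by rewrite /fps_deriv subSn// -ltnS.
Qed.

End FpsCalculus.

Lemma fps_mapM (A B : comNzRingType) (phi : {rmorphism A -> B}) (f g : fps A) :
  fps_map phi (f * g) = fps_map phi f * fps_map phi g.
Proof.
apply/funext => n; rewrite /fps_map !fps_mulE rmorph_sum.
by apply: eq_bigr => i _; rewrite rmorphM.
Qed.

Lemma fps_map_1m2X (A B : comNzRingType) (phi : {rmorphism A -> B}) :
  fps_map phi (1 - 2 * fps_X) = 1 - 2 * fps_X :> fps B.
Proof.
apply/funext => n; rewrite /fps_map -[1 - _]mulr1 -[in RHS](mulr1 (1 - _)).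
case: n => [|n]; first by rewrite !fps_mul_1m2X0 rmorph1.
by rewrite !fps_mul_1m2XS !fps_1E rmorphB rmorphM !rmorph_nat.
Qed.

(** Dividing h by its leading power of the variable leaves an invertible
    series, and multiplication by the variable only shifts coefficients. *)
Lemma fps_mulIf (K : fieldType) (f g h : fps K) :
  h != 0 -> f * h = g * h -> f = g.
Proof.
move=> /fps_orderP[hm h_lt] /eqP; rewrite -subr_eq0 -mulrBl => /eqP fgh0.
have {fgh0} fgh0 : (f - g) * fps_shift (fps_order h) h = 0.
  set m := fps_order h in h_lt *; apply/funext => n.
  have XM k (u : fps K) : (fps_X ^+ k * u) (k + n)%N = u n.
    elim: k u => [|k IHk] u; first by rewrite mul1r.
    by rewrite exprS -mulrA fps_mulXS IHk.
  by rewrite -(XM m) mulrC -mulrA (fps_shiftK h_lt) fgh0.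
apply/eqP; rewrite -subr_eq0; apply/eqP.
rewrite -[LHS]mulr1 -(@fps_mulVf _ (fps_shift (fps_order h) h)).
  by rewrite mulrCA fgh0 mulr0.
by rewrite /fps_shift add0n.
Qed.

(** * The series of the rising factorials, with polynomial coefficients *)

Section RisingFactorial.
Variable K : numFieldType.

Definition ln_sqrt1m2 : fps K := 2^-1 *: fps_dilate (- 2) (fps_ln1D K).

Lemma ln_sqrt1m2S n : ln_sqrt1m2 n.+1 *+ n.+1 = - 2 ^+ n.
Proof.
rewrite /ln_sqrt1m2 fps_scaleE /fps_dilate /= -[LHS]mulr_natr.
transitivity (- ((- 2) ^+ n * (- 1) ^+ n) : K); last first.
  by rewrite -exprMn mulrN1 opprK.
by rewrite exprS; field; rewrite addrC natr1.
Qed.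

(** L' = - 1 / (1 - 2 t), cleared of its denominator: a property of the
    coefficients of the logarithm that the Leibniz rule can use. *)
Lemma deriv_ln_sqrt1m2 : (1 - 2 * fps_X) * fps_deriv ln_sqrt1m2 = - 1.
Proof.
apply/funext => -[|n]; first by rewrite fps_mul_1m2X0 [LHS]ln_sqrt1m2S.
rewrite fps_mul_1m2XS /fps_deriv !ln_sqrt1m2S fps_oppE fps_1E exprS oppr0.
by rewrite mulrN subrr.
Qed.

Definition rising_poly (n : nat) : {poly K} :=
  \prod_(1 <= i < n.+1) ('X + (2 * i - 1)%N%:R).

(** (1 - 2 t)^(- (x + 1) / 2), with 'X standing for x. *)
Definition rising_gf : fps {poly K} := fun n => n`!%:R^-1 *: rising_poly n.

Lemma rising_gf0 : rising_gf 0%N = 1.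
Proof. by rewrite /rising_gf /rising_poly big_nil invr1 scale1r. Qed.

Lemma rising_gfS n :
  rising_gf n.+1 *+ n.+1 = ('X + (2 * n + 1)%:R) * rising_gf n.
Proof.
rewrite /rising_gf /rising_poly big_nat_recr//= factS natrM invfM -scaler_nat.
rewrite scalerA mulrA mulfV ?pnatr_eq0// mul1r -scalerAr mulrC.
by rewrite (_ : (2 * n.+1 - 1 = 2 * n + 1)%N)// mulnS subn1 addn1.
Qed.

Lemma deriv_t_rising_gf :
  (1 - 2 * fps_X) * fps_deriv rising_gf = fps_C ('X + 1) * rising_gf.
Proof.
apply/funext => -[|n].
  by rewrite fps_mul_1m2X0 fps_mulCE [LHS]rising_gfS muln0.
rewrite fps_mul_1m2XS fps_mulCE /fps_deriv rising_gfS.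
by move: (rising_gf n.+1) => b; ring.
Qed.

Lemma poly_natmulI n (p q : {poly K}) : p *+ n.+1 = q *+ n.+1 -> p = q.
Proof.
rewrite -[p *+ _]mulr_natl -[q *+ _]mulr_natl; apply: mulfI.
by rewrite -polyC_natr polyC_eq0 pnatr_eq0.
Qed.

(** Both sides solve (1 - 2 t) Y' = rising_gf + (x + 1) Y with Y(0) = 0: the
    left-hand side by differentiating [deriv_t_rising_gf] in x, the right-hand
    side by the Leibniz rule in t.  The equation, read as a recurrence on the
    coefficients, has only one solution. *)
Lemma deriv_x_rising_gf :
  fps_map (@deriv K) rising_gf =
  - (fps_map polyC ln_sqrt1m2 * rising_gf).
Proof.
set L := fps_map _ ln_sqrt1m2; set M := - (L * rising_gf).
have dL : (1 - 2 * fps_X) * fps_deriv L = - 1.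
  have -> : fps_deriv L = fps_map polyC (fps_deriv ln_sqrt1m2).
    by apply/funext => n; rewrite /fps_deriv /L /fps_map polyCMn.
  rewrite -(fps_map_1m2X polyC) -fps_mapM deriv_ln_sqrt1m2.
  by apply/funext => n; rewrite /fps_map !fps_oppE !fps_1E rmorphN rmorph_nat.
have dM : (1 - 2 * fps_X) * fps_deriv M = rising_gf + fps_C ('X + 1) * M.
  have -> : fps_deriv M = - fps_deriv (L * rising_gf).
    by apply/funext => n; rewrite /fps_deriv fps_oppE mulNrn.
  rewrite fps_derivM /M.
  transitivity (- ((1 - 2 * fps_X) * fps_deriv L) * rising_gf
    - L * ((1 - 2 * fps_X) * fps_deriv rising_gf)).
    (* Generalizing keeps [ring] from unfolding the series. *)
    clear M dL.
    by move: L rising_gf (fps_deriv L) (fps_deriv _) (1 - _) => a b c d e; ring.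
  rewrite dL deriv_t_rising_gf.
  by clear M dL; move: (fps_C _) L rising_gf => a b c; ring.
have MS n : M n.+1 *+ n.+1 =
    rising_gf n + ('X + (2 * n + 1)%:R) * M n.
  case: n => [|n].
    have := congr1 (fun f : fps {poly K} => f 0%N) dM.
    by rewrite fps_mul_1m2X0 fps_addE fps_mulCE muln0.
  have := congr1 (fun f : fps {poly K} => f n.+1) dM.
  rewrite fps_mul_1m2XS fps_addE fps_mulCE /fps_deriv => /eqP.
  rewrite subr_eq => /eqP ->.
  by move: (rising_gf n.+1) (M n.+1) => a b; ring.
apply/funext; elim=> [|n IHn].
  rewrite /fps_map rising_gf0 derivC /M fps_oppE fps_mulE big_ord1.
  rewrite /L /fps_map /ln_sqrt1m2 fps_scaleE /fps_dilate /= !mulr0.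
  by rewrite polyC0 mul0r oppr0.
apply: (@poly_natmulI n); rewrite MS -IHn /fps_map -derivMn rising_gfS.
by rewrite derivM derivD derivX -polyC_natr derivC addr0 mul1r.
Qed.

(** (1 - 2 t)^(- (x + 1) / 2) for a scalar x, see [pow1m2_binomial]. *)
Definition pow1m2 (x : K) : fps K := fun n => (rising_gf n).[x].

Lemma pow1m2S x n : pow1m2 x n.+1 *+ n.+1 = (x + (2 * n + 1)%:R) * pow1m2 x n.
Proof.
rewrite /pow1m2 -hornerMn rising_gfS hornerM hornerD hornerX.
by rewrite -polyC_natr hornerC.
Qed.

Lemma pow1m2_binomial x :
  pow1m2 x = fps_dilate (- 2) (fps_binomial (- (x + 1) / 2)).
Proof.
apply/funext; elim=> [|n IHn].
  rewrite /pow1m2 rising_gf0 hornerC /fps_dilate /fps_binomial big_ord0.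
  by rewrite divr1 mulr1.
have n0 : n.+1%:R != 0 :> K by rewrite pnatr_eq0.
apply: (mulIf n0); rewrite mulr_natr pow1m2S IHn /fps_dilate /fps_binomial.
rewrite big_ord_recr/= factS natrM exprS natrD natrM.
have f0 : n`!%:R != 0 :> K by rewrite pnatr_eq0 -lt0n fact_gt0.
by field; rewrite f0 addrC natr1 n0.
Qed.

(** The factors x - 1, x + 1, x + 3, ... of the rising factorial of x - 2 are
    x - 1 followed by those of the rising factorial of x. *)
Lemma pow1m2_sub2S x n : pow1m2 (x - 2) n.+1 *+ n.+1 = (x - 1) * pow1m2 x n.
Proof.
elim: n => [|n IHn].
  by rewrite pow1m2S /pow1m2 rising_gf0 !hornerC; ring.
apply: (mulIf (_ : n.+1%:R != 0 :> K)); first by rewrite pnatr_eq0.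
rewrite pow1m2S -mulrA mulr_natr IHn.
rewrite -[RHS]mulrA [pow1m2 x n.+1 * _]mulr_natr pow1m2S.
by move: (pow1m2 x n) => a; ring.
Qed.

Lemma mul_pow1m2 x : (1 - 2 * fps_X) * pow1m2 x = pow1m2 (x - 2).
Proof.
apply/funext => -[|n].
  by rewrite fps_mul_1m2X0 /pow1m2 rising_gf0 !hornerC.
apply: (mulIf (_ : n.+1%:R != 0 :> K)); first by rewrite pnatr_eq0.
rewrite fps_mul_1m2XS mulrBl !mulr_natr pow1m2_sub2S pow1m2S -mulr_natr.
by move: (pow1m2 x n) => a; ring.
Qed.

Lemma pow1m2_N1 : pow1m2 (- 1) = 1.
Proof.
apply/funext => -[|n]; first by rewrite /pow1m2 rising_gf0 hornerC.
apply: (mulIf (_ : n.+1%:R != 0 :> K)); first by rewrite pnatr_eq0.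
have -> : - 1 = 1 - 2 :> K by ring.
by rewrite mulr_natr pow1m2_sub2S subrr fps_1E !mul0r.
Qed.

End RisingFactorial.

(** * Integration over [0, 1] *)

Section Integration.
Variable R : realType.
Implicit Types p q : {poly R}.

Definition int01 (p : {poly R}) : R :=
  (\int[lebesgue_measure]_(x in `[0%R, 1%R]%classic) p.[x])%R.

Lemma integrable_horner p :
  lebesgue_measure.-integrable `[0%R, 1%R]%classic (EFin \o horner p).
Proof.
apply: continuous_compact_integrable; first exact: segment_compact.
by apply: continuous_subspaceT => x; exact: continuous_horner.
Qed.

Lemma int01D p q : int01 (p + q) = int01 p + int01 q.
Proof.
rewrite /int01 -RintegralD//; [|exact: integrable_horner..].
by apply: eq_Rintegral => x _; rewrite hornerD.
Qed.

Lemma int01Z c p : int01 (c *: p) = c * int01 p.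
Proof.
rewrite /int01 -RintegralZl//; last exact: integrable_horner.
by apply: eq_Rintegral => x _; rewrite hornerZ.
Qed.

Lemma int01N p : int01 (- p) = - int01 p.
Proof. by rewrite -scaleN1r int01Z mulN1r. Qed.

Lemma int01_sum n (F : 'I_n -> {poly R}) :
  int01 (\sum_(i < n) F i) = \sum_(i < n) int01 (F i).
Proof.
apply: (big_morph int01 int01D).
by rewrite -(scale0r 0) int01Z mul0r.
Qed.

Lemma int01_deriv p : int01 p^`() = p.[1] - p.[0].
Proof.
have cp q : {within `[0%R, 1%R], continuous (horner q)}%classic.
  by apply: continuous_subspaceT => x; exact: continuous_horner.
rewrite /int01 /Rintegral.
rewrite (continuous_FTC2 (F := horner p) (f := horner p^`()) _ (cp _))//.
  split; first by move=> x _; exact: derivable_horner.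
    by apply: cvg_at_right_filter; exact: continuous_horner.
  by apply: cvg_at_left_filter; exact: continuous_horner.
by move=> x _; rewrite derivE.
Qed.

Lemma egf_cauchyB n : egf (cauchyB R) n = int01 (rising_gf R n).
Proof.
rewrite /rising_gf int01Z /egf mulrC; congr (_ * _).
apply: eq_Rintegral => x _; rewrite /rising_poly horner_prod.
apply: eq_bigr => i _.
by rewrite hornerD hornerX -polyC_natr hornerC.
Qed.

(** The coefficientwise integral in x of [deriv_x_rising_gf]; the logarithm does
    not depend on x and comes out of the integral. *)
Lemma ln_sqrt1m2_mul_egf :
  ln_sqrt1m2 R * egf (cauchyB R) = pow1m2 0 - pow1m2 1.
Proof.
apply/funext => n; apply: oppr_inj.
rewrite fps_addE fps_oppE opprB -int01_deriv.
have /(congr1 (fun f : fps {poly R} => f n)) := deriv_x_rising_gf R.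
rewrite /fps_map => ->; rewrite fps_oppE int01N.
rewrite !fps_mulE int01_sum; congr (- _); apply: eq_bigr => i _.
by rewrite mul_polyC int01Z egf_cauchyB.
Qed.

(** * Comparison with the rational series *)

Lemma ratr_ln_sqrt1m2X : fps_map ratr ln_sqrt1m2X = ln_sqrt1m2 R.
Proof.
apply/funext => n; rewrite /fps_map /ln_sqrt1m2X /ln_sqrt1m2 !fps_scaleE.
rewrite rmorphM fmorphV rmorph_nat; congr (_ * _).
rewrite /ln1m2X /fps_dilate rmorphM rmorphXn rmorphN rmorph_nat.
case: n => [|n]; first by rewrite rmorph0.
by rewrite /= rmorphM fmorphV rmorph_nat rmorphXn rmorphN1.
Qed.

Lemma ratr_sqrt1m2X : fps_map ratr sqrt1m2X = pow1m2 (- 2) :> fps R.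
Proof.
apply/funext => n; rewrite pow1m2_binomial /fps_map /sqrt1m2X /fps_dilate.
rewrite rmorphM rmorphXn rmorphN rmorph_nat; congr (_ * _).
rewrite /fps_binomial rmorphM fmorphV rmorph_nat rmorph_prod; congr (_ / _).
apply: eq_bigr => i _; rewrite rmorphB fmorphV !rmorph_nat; congr (_ - _).
by field.
Qed.

Lemma egf_mul_denominator :
  egf (cauchyB R) * ((2 * fps_X - 1) * ln_sqrt1m2 R) = 1 - pow1m2 (- 2).
Proof.
transitivity (- ((1 - 2 * fps_X) * (ln_sqrt1m2 R * egf (cauchyB R)))).
  by move: (ln_sqrt1m2 R) (egf _) fps_X => a b c; ring.
rewrite ln_sqrt1m2_mul_egf mulrBr !mul_pow1m2 opprB.
by rewrite (_ : 1 - 2 = - 1) ?pow1m2_N1 ?sub0r//; ring.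
Qed.

End Integration.

Lemma fps_order0 (K : fieldType) : fps_order (0 : fps K) = 0%N.
Proof.
rewrite /fps_order; case: pselect => // -[n /[dup]].
by rewrite eqxx.
Qed.

Theorem theorem2p7 (R : realType) :
  egf (cauchyB R) =
  fps_map ratr
    (fps_div (1 - sqrt1m2X) ((2 * fps_X - 1) * ln_sqrt1m2X)) :> fps R.
Proof.
set N := 1 - sqrt1m2X; set D := _ * ln_sqrt1m2X.
have D0 : D != 0.
  by apply/eqP => D0; have := fps_order_denominator; rewrite -/D D0 fps_order0.
have N0 : N != 0.
  by apply/eqP => N0; have := fps_order_numerator; rewrite -/N N0 fps_order0.
have divK : fps_div N D * D = N.
  apply: fps_divK => // n; rewrite fps_order_denominator => n1.
  by apply: (fps_orderP N0).2; rewrite fps_order_numerator.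
have ratrD : fps_map ratr D = (2 * fps_X - 1) * ln_sqrt1m2 R.
  rewrite fps_mapM ratr_ln_sqrt1m2X; congr (_ * _).
  rewrite -[2 * _ - 1]opprB -[in RHS](opprB _ (2 * _)).
  rewrite -(fps_map_1m2X (@ratr R)); apply/funext => n.
  by rewrite /fps_map !fps_oppE rmorphN.
have ratrN : fps_map ratr N = 1 - pow1m2 (- 2) :> fps R.
  rewrite -ratr_sqrt1m2X; apply/funext => n.
  by rewrite /fps_map !fps_addE !fps_oppE !fps_1E rmorphB rmorph_nat.
apply: (@fps_mulIf _ _ _ (fps_map ratr D)); last first.
  by rewrite -fps_mapM divK ratrN ratrD egf_mul_denominator.
have [D1 _] := fps_orderP D0.
apply: contraNneq D1 => /(congr1 (fun f : fps R => f (fps_order D))).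
by rewrite /fps_map => /eqP; rewrite fmorph_eq0.
Qed.
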